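(* Let $k:[0,+\infty)\to[0,+\infty)$ be a convex, strictly increasing function, continuous at $0$, with $k(0)=0$, and let $g:[0,+\infty)\to[0,+\infty)$ be the invertible function whose inverse is $g^{-1}(t)=k(t)+t^{2}$. Let $\rho$ be the left invariant distance on the Heisenberg group $H(1)$ determined by $\rho(\tilde x)=\max\{\|x\|,g(|\bar x|)\}$ for $\tilde x=(x,\bar x)$, and let $\bar\delta$ be the field of dilatations on $H(1)$ given by $\bar\delta^{\tilde x}_{\varepsilon}\tilde y=\tilde x\,\bar\delta_\varepsilon(\tilde x^{-1}\tilde y)$, where $\bar\delta_\varepsilon(x,\bar x)=\left(\varepsilon x,\ \mathrm{sgn}(\bar x)\,g^{-1}(\varepsilon\, g(|\bar x|))\right)$ for $\varepsilon>0$. Let $d$ be the left invariant distance on $H(1)$ determined by $d((0,0),(x,\bar x))=\max\{\|x\|,\sqrt{|\bar x|}\}$. If the triple $(H(1),\rho,\bar\delta)$ is a dilatation structure, then the identity map $\mathrm{id}$ is metrically differentiable (at every point) from $(H(1),d)$ to $(H(1),\rho)$.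
   Context: Heisenberg group: $H(1)=\mathbb{R}^2\times\mathbb{R}$, with elements written $\tilde x=(x,\bar x)$, $x\in\mathbb{R}^2$, $\bar x\in\mathbb{R}$, and group operation $(x,\bar x)(y,\bar y)=(x+y,\ \bar x+\bar y+2\omega(x,y))$, where $\omega$ is the canonical symplectic form on $\mathbb{R}^2$; $\|\cdot\|$ is the Euclidean norm on $\mathbb{R}^2$ and the neutral element is $(0,0)$. The standard dilatations of $(H(1),d)$ are $\delta_\varepsilon(x,\bar x)=(\varepsilon x,\varepsilon^2\bar x)$, $\varepsilon>0$; $(H(1),d,\delta)$ is a conical (Carnot) group. The distance $\rho$: the same symbol denotes the function $\rho(\tilde x)=\max\{\|x\|,g(|\bar x|)\}$ and the distance $\rho(\tilde x,\tilde y)=\rho(\tilde x^{-1}\tilde y)$. It is a known theorem of Kirchheim and Magnani that, for $g$ as in the claim, this is a left invariant distance on $H(1)$. Metric differentiability. A seminorm on $(N,d,\delta)$ (here $N=H(1)$) is a continuous function $\eta:N\to[0,+\infty)$ such that $\eta(\delta_\varepsilon x)=\varepsilon\eta(x)$ for all $x\in N$, $\varepsilon>0$, and $\eta(xy)\le\eta(x)+\eta(y)$ for all $x,y\in N$. For an open set $A\subset N$, a metric space $(X,\rho)$ and $x\in A$, a function $f:A\to X$ is metrically differentiable in $x$ if there is a seminorm $\eta_x:N\to[0,+\infty)$ such that $\left|\frac1\varepsilon\rho(f(x\,\delta_\varepsilon v),f(x))-\eta_x(v)\right|\to0$ as $\varepsilon\to0$, uniformly with respect to $v$ in compact neighbourhoods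 of the neutral element. Dilatation structures. Let $(X,d)$ be a complete metric space in which closed balls are compact, and suppose that to every $x\in X$ and $\varepsilon\in(0,+\infty)$ is assigned a homeomorphism $\delta^x_\varepsilon:X\to X$ (in the general definition the dilatations may be only locally defined; here they are globally defined and the neighbourhoods below are domains to which they are restricted). Write $B_d(x,r)$, $\bar B_d(x,r)$ for open and closed balls. The triple $(X,d,\delta)$ is a dilatation structure if the following axioms A0-A4 hold, with the functions $d^x$ in A3 non-degenerate ($d^x(u,v)=0$ implies $u=v$). A0. There are numbers $1<A<B$ and, for every $x\in X$, open neighbourhoods $U(x)$ of $x$, $V_\varepsilon(x)$ of $x$ (for $\varepsilon\in(0,1]$) and $W_\varepsilon(x)$ of $x$ (for $\varepsilon>1$), such that $\bar B_d(x,A)\subset U(x)$, $\delta^x_\varepsilon$ restricts to a homeomorphism from $U(x)$ onto $V_\varepsilon(x)$ for $\varepsilon\in(0,1]$, and for all $\varepsilon\in(0,1)$: $B_d(x,\varepsilon)\subset\delta^x_\varepsilon B_d(x,A)\subset V_\varepsilon(x)\subset W_{\varepsilon^{-1}}(x)\subset\delta^x_\varepsilon B_d(x,B)$. Moreover, for any compact $K\subset X$ there are $R=R(K)>0$ and $\varepsilon_0=\varepsilon_0(K)\in(0,1)$ such that for all $x\in K$, all $u,v\in\bar B_d(x,R)$ and all $\varepsilon\in(0,\varepsilon_0)$, $\delta^x_\varepsilon v\in W_{\varepsilon^{-1}}(\delta^x_\varepsilon u)$. A1. $\delta^x_\varepsilon x=x$ and $\delta^x_1=\mathrm{id}$ for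 all $x$ and $\varepsilon$; the map $(\varepsilon,x,y)\mapsto\delta^x_\varepsilon y$ is continuous on $(0,+\infty)\times X\times X$ and extends continuously to $\varepsilon=0$ with $\lim_{\varepsilon\to0}\delta^x_\varepsilon y=x$. A2. $\delta^x_\varepsilon\delta^x_\mu u=\delta^x_{\varepsilon\mu}u$ for all $x,u\in X$ and $\varepsilon,\mu\in(0,+\infty)$. A3. There is $A>1$ (the one in A0) such that for each $x\in X$ there is a function $(u,v)\mapsto d^x(u,v)$ defined on $\bar B_d(x,A)\times\bar B_d(x,A)$ with $\lim_{\varepsilon\to0}\sup\left\{\left|\frac1\varepsilon d(\delta^x_\varepsilon u,\delta^x_\varepsilon v)-d^x(u,v)\right| : u,v\in\bar B_d(x,A)\right\}=0$, uniformly with respect to $x$ in compact sets. A4. With $\Delta^x_\varepsilon(u,v)=\delta^{\delta^x_\varepsilon u}_{\varepsilon^{-1}}\delta^x_\varepsilon v$, the limit $\lim_{\varepsilon\to0}\Delta^x_\varepsilon(u,v)=\Delta^x(u,v)$ exists, uniformly with respect to $x,u,v$ in compact sets. For $(H(1),\rho,\bar\delta)$, by left invariance, A4 takes the following form: with $\bar\beta_\varepsilon(\tilde x,\tilde y)=\bar\delta_{\varepsilon^{-1}}\left(\bar\delta_\varepsilon(\tilde x)\,\bar\delta_\varepsilon(\tilde y)\right)$, the limit $\lim_{\varepsilon\to0}\bar\beta_\varepsilon(\tilde x,\tilde y)=\bar\beta(\tilde x,\tilde y)\in H(1)$ exists, uniformly with respect to $\tilde x,\tilde y$ in any compact set $K$.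 *)

(* Defs.v *)
From HB Require Import structures.
From mathcomp Require Import all_boot all_order all_algebra.
From mathcomp Require Import ring lra.
From mathcomp Require Import all_classical all_reals all_analysis.

Set Implicit Arguments.
Unset Strict Implicit.
Unset Printing Implicit Defensive.

Import Order.TTheory GRing.Theory Num.Theory.
Import numFieldNormedType.Exports.

Local Open Scope classical_set_scope.
Local Open Scope ring_scope.

(* A function [N] of this kind determines a unique left invariant distance [d]
   with [d 1 x = N x], namely [d x y = N (x^-1 * y)]. *)
Record group_norm (R : realType) (G : groupType) (N : G -> R) : Prop :=
  GroupNorm {
    group_norm1 : N 1%g = 0 ;
    group_norm_eq0 : forall x, N x = 0 -> x = 1%g ;
    group_normV : forall x, N (x^-1)%g = N x ;
    group_normM : forall x y, N (x * y)%g <= N x + N y }.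

(* The group [G] itself, as a metric space for the left invariant distance
   determined by [N]; the proof [hN] selects the metric structure, so that
   several distances can coexist on the same group. *)
Definition left_inv_metric (R : realType) (G : groupType) (N : G -> R)
  (hN : group_norm N) : Type := G.

Section left_inv_metric_instances.
Context (R : realType) (G : groupType) (N : G -> R) (hN : group_norm N).

Let dist (x y : G) : R := N (x^-1 * y)%g.

Let distxx x : dist x x = 0.
Proof. by rewrite /dist mulVg group_norm1. Qed.

Let dist_positivity x y : dist x y = 0 -> x = y.
Proof. by move=> /(group_norm_eq0 hN) /(canRL (mulVKg _)); rewrite mulg1. Qed.

Let dist_sym x y : dist x y = dist y x.
Proof. by rewrite /dist -(group_normV hN) invgM invgK. Qed.

Let dist_triangle y x z : dist x z <= dist x y + dist y z.
Proof.
rewrite /dist (_ : (x^-1 * z = (x^-1 * y) * (y^-1 * z))%g).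
  exact: group_normM.
by rewrite -mulgA mulVKg.
Qed.

HB.instance Definition _ := Group.on (left_inv_metric hN).
HB.instance Definition _ := isMetric.Build R (left_inv_metric hN)
  distxx dist_positivity dist_sym dist_triangle.

Lemma left_inv_mdistE (x y : left_inv_metric hN) :
  mdist x y = N ((x : G)^-1 * (y : G))%g.
Proof. by []. Qed.

End left_inv_metric_instances.

Section metric_differentiability.
Context (R : realType) (G : groupType) (N : G -> R) (hN : group_norm N).
Let H := left_inv_metric hN.
(* [dil e] is only meaningful for [0 < e]. *)
Variable dil : R -> G -> G.

Record seminorm (eta : H -> R) : Prop := Seminorm {
  seminorm_continuous : continuous eta ;
  seminorm_ge0 : forall x, 0 <= eta x ;
  seminorm_dil : forall (e : R) x, 0 < e -> eta (dil e x) = e * eta x ;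
  seminormM : forall x y, eta (x * y)%g <= eta x + eta y }.

(* [f] stands for a function on the open set [A]: its values off [A] play no
   role. For [K] compact, [x * dil e v] is in [A] for all [v] in [K] as soon as
   [e] is small enough. *)
Definition metrically_differentiable (X : metricType R) (A : set H)
    (f : H -> X) (x : H) : Prop :=
  [/\ open A, A x & exists2 eta : H -> R, seminorm eta &
    forall K : set H, compact K -> nbhs (1%g : H) K ->
    forall r : R, 0 < r -> \forall e \near 0^'+, forall v, K v ->
      A (x * dil e v)%g ->
      `| e^-1 * mdist (f (x * dil e v)%g) (f x) - eta v | < r].

End metric_differentiability.

Definition homeomorphism_between (T U : topologicalType) (A : set T)
    (B : set U) (f : T -> U) : Prop :=
  {within A, continuous f} /\
  exists g : U -> T, {within B, continuous g} /\
    [/\ forall x, A x -> B (f x), forall y, B y -> A (g y),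
        forall x, A x -> g (f x) = x & forall y, B y -> f (g y) = y].

Section dilatation_structure.
Context (R : realType) (X : metricType R).
(* [delta x e] is the dilatation based at [x] of coefficient [e]; it is only
   meaningful for [0 < e]. *)
Variable delta : X -> R -> X -> X.

(* Closed balls in the metric sense; [closed_ball] is the closure of an open
   ball, which may be smaller. *)
Definition cball (x : X) (r : R) : set X := [set y | mdist x y <= r].

Definition complete_metric : Prop :=
  forall F : set_system X, ProperFilter F -> cauchy F ->
  exists l : X, F --> l.

Definition dilatation_A0 (A B : R) : Prop :=
  exists (U : X -> set X) (V W : R -> X -> set X),
  [/\ forall x, open_nbhs x (U x) /\ cball x A `<=` U x,
      forall x (e : R), 0 < e <= 1 -> open_nbhs x (V e x),
      forall x (e : R), 1 < e -> open_nbhs x (W e x),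
      forall x (e : R), 0 < e <= 1 ->
        homeomorphism_between (U x) (V e x) (delta x e) &
      (forall x (e : R), 0 < e < 1 ->
        [/\ ball x e `<=` delta x e @` ball x A,
            delta x e @` ball x A `<=` V e x,
            V e x `<=` W e^-1 x &
            W e^-1 x `<=` delta x e @` ball x B]) /\
      (forall K : set X, compact K ->
        exists r e0 : R, [/\ 0 < r, 0 < e0 < 1 &
          forall x u v (e : R), K x -> cball x r u -> cball x r v -> 0 < e < e0 ->
            W e^-1 (delta x e u) (delta x e v)])].

Definition dilatation_A1 : Prop :=
  [/\ forall x (e : R), 0 < e -> delta x e x = x,
      forall x y, delta x 1 y = y,
      {within [set p : R * X * X | 0 < p.1.1],
        continuous (fun p : R * X * X => delta p.1.2 p.1.1 p.2)} &
      forall x y : X,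
        delta p.1.2 p.1.1 p.2 @[p --> within [set p : R * X * X | 0 < p.1.1]
                                  (nbhs ((0, x, y) : R * X * X))] --> x].

Definition dilatation_A2 : Prop :=
  forall x u (e m : R), 0 < e -> 0 < m ->
    delta x e (delta x m u) = delta x (e * m) u.

(* Includes the non-degeneracy of the functions [dx x]. *)
Definition dilatation_A3 (A : R) : Prop :=
  exists dx : X -> X -> X -> R,
  (forall x u v, cball x A u -> cball x A v -> dx x u v = 0 -> u = v) /\
  forall K : set X, compact K -> forall r : R, 0 < r ->
  \forall e \near 0^'+, forall x, K x ->
  forall u v, cball x A u -> cball x A v ->
    `| e^-1 * mdist (delta x e u) (delta x e v) - dx x u v | < r.

Definition Delta (e : R) (x u v : X) : X :=
  delta (delta x e u) e^-1 (delta x e v).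

Definition dilatation_A4 : Prop :=
  exists Delta0 : X -> X -> X -> X,
  forall K : set X, compact K -> forall r : R, 0 < r ->
  \forall e \near 0^'+, forall x u v, K x -> K u -> K v ->
    mdist (Delta e x u v) (Delta0 x u v) < r.

Record dilatation_structure : Prop := DilatationStructure {
  dilatation_complete : complete_metric ;
  dilatation_proper : forall x r, compact (cball x r) ;
  dilatation_homeo : forall x (e : R), 0 < e ->
    homeomorphism_between [set: X] [set: X] (delta x e) ;
  dilatation_A0_A3 : exists A B : R,
    [/\ 1 < A, A < B, dilatation_A0 A B & dilatation_A3 A] ;
  dilatation_A1P : dilatation_A1 ;
  dilatation_A2P : dilatation_A2 ;
  dilatation_A4P : dilatation_A4 }.

End dilatation_structure.

Definition heisenberg (R : realType) : Type := ((R * R) * R)%type.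

Section heisenberg_group.
Context (R : realType).
Implicit Types (x y : heisenberg R) (p q : R * R).

(* Sign convention for the symplectic form: [omega e1 e2 = 1]. *)
Definition omega p q : R := p.1 * q.2 - p.2 * q.1.

Definition enorm p : R := Num.sqrt (p.1 ^+ 2 + p.2 ^+ 2).

Definition heis_one : heisenberg R := ((0, 0), 0).
Definition heis_inv x : heisenberg R := ((- x.1.1, - x.1.2), - x.2).
Definition heis_mul x y : heisenberg R :=
  ((x.1.1 + y.1.1, x.1.2 + y.1.2), x.2 + y.2 + 2 * omega x.1 y.1).

Let heis_mulA : associative heis_mul.
Proof.
move=> [[x1 x2] x3] [[y1 y2] y3] [[z1 z2] z3].
by rewrite /heis_mul /omega /=; congr (_, _, _); ring.
Qed.

Let heis_mul1 : left_id heis_one heis_mul.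
Proof.
move=> [[x1 x2] x3].
by rewrite /heis_mul /heis_one /omega /=; congr (_, _, _); ring.
Qed.

Let heis_mulr1 : right_id heis_one heis_mul.
Proof.
move=> [[x1 x2] x3].
by rewrite /heis_mul /heis_one /omega /=; congr (_, _, _); ring.
Qed.

Let heis_mulV : left_inverse heis_one heis_inv heis_mul.
Proof.
move=> [[x1 x2] x3].
by rewrite /heis_mul /heis_inv /heis_one /omega /=; congr (_, _, _); ring.
Qed.

Let heis_mulrV : right_inverse heis_one heis_inv heis_mul.
Proof.
move=> [[x1 x2] x3].
by rewrite /heis_mul /heis_inv /heis_one /omega /=; congr (_, _, _); ring.
Qed.

HB.instance Definition _ := Choice.on (heisenberg R).
HB.instance Definition _ := isGroup.Build (heisenberg R)
  heis_mulA heis_mul1 heis_mulr1 heis_mulV heis_mulrV.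

Lemma heis_oneE : (1%g : heisenberg R) = ((0, 0), 0).
Proof. by []. Qed.

Lemma heis_invE x : (x^-1)%g = ((- x.1.1, - x.1.2), - x.2) :> heisenberg R.
Proof. by []. Qed.

Lemma heis_mulE x y :
  (x * y)%g = ((x.1.1 + y.1.1, x.1.2 + y.1.2), x.2 + y.2 + 2 * omega x.1 y.1)
  :> heisenberg R.
Proof. by []. Qed.

Definition heis_dil (e : R) x : heisenberg R :=
  ((e * x.1.1, e * x.1.2), e ^+ 2 * x.2).

Definition max_gauge (g : R -> R) x : R := Num.max (enorm x.1) (g `|x.2|).

Lemma enorm_ge0 p : 0 <= enorm p.
Proof. exact: sqrtr_ge0. Qed.

Lemma enorm_sqr p : enorm p ^+ 2 = p.1 ^+ 2 + p.2 ^+ 2.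
Proof. by rewrite sqr_sqrtr// addr_ge0// sqr_ge0. Qed.

Lemma enorm_eq0 p : enorm p = 0 -> p = (0, 0).
Proof.
move=> p0; have := enorm_sqr p; rewrite p0 expr0n/= => /esym/eqP.
rewrite paddr_eq0 ?sqr_ge0// !sqrf_eq0.
by case: p {p0} => a b /= /andP[/eqP-> /eqP->].
Qed.

Lemma normr_omega p q : `|omega p q| <= enorm p * enorm q.
Proof.
rewrite -ler_sqr ?nnegrE ?mulr_ge0 ?enorm_ge0// exprMn !enorm_sqr.
rewrite real_normK ?num_real// /omega -subr_ge0.
rewrite (_ : _ - _ = (p.1 * q.1 + p.2 * q.2) ^+ 2); first exact: sqr_ge0.
by ring.
Qed.

Lemma enormD p q : enorm (p.1 + q.1, p.2 + q.2) <= enorm p + enorm q.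
Proof.
rewrite -ler_sqr ?nnegrE ?addr_ge0 ?enorm_ge0//.
rewrite sqrrD !enorm_sqr /=.
have : p.1 * q.1 + p.2 * q.2 <= enorm p * enorm q.
  apply: le_trans (ler_norm _) _.
  rewrite -ler_sqr ?nnegrE ?mulr_ge0 ?enorm_ge0// exprMn !enorm_sqr.
  rewrite real_normK ?num_real// -subr_ge0.
  rewrite (_ : _ - _ = (p.1 * q.2 - p.2 * q.1) ^+ 2); first exact: sqr_ge0.
  by ring.
nra.
Qed.

Lemma max_gauge_norm (h g : R -> R) :
  h 0 = 0 -> (forall t : R, 0 <= t -> 0 <= h t) ->
  (forall s t : R, 0 <= s -> 0 <= t -> h s + h t <= h (s + t)) ->
  (forall t : R, 0 <= t -> 0 <= g t) ->
  (forall t : R, 0 <= t -> g (h t + t ^+ 2) = t) ->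
  (forall t : R, 0 <= t -> h (g t) + g t ^+ 2 = t) ->
  group_norm (max_gauge g).
Proof.
move=> h0 hge0 hD gge0 ginvK gK.
have g0 : g 0 = 0 by have := ginvK 0 (lexx 0); rewrite h0 expr0n/= addr0.
have mono s t : 0 <= s -> 0 <= t -> s <= t -> h s + s ^+ 2 <= h t + t ^+ 2.
  move=> s0 t0 st; have := hD s (t - s) s0; rewrite subr_ge0 => /(_ st).
  have := hge0 (t - s); rewrite subr_ge0 => /(_ st).
  rewrite subrKC; nra.
have gle u c : 0 <= u -> 0 <= c -> u <= h c + c ^+ 2 -> g u <= c.
  move=> u0 c0 uc; rewrite leNgt; apply/negP => cu.
  have gu0 := gge0 u u0.
  have e := mono _ _ c0 gu0 (ltW cu); rewrite gK// in e.
  have {}e : u = h c + c ^+ 2 by apply/eqP; rewrite eq_le uc e.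
  by move: cu; rewrite e ginvK// ltxx.
have leg u c : 0 <= u -> g u <= c -> u <= h c + c ^+ 2.
  move=> u0 guc; rewrite -[leLHS](gK _ u0); apply: mono => //.
  - exact: gge0.
  - exact: le_trans (gge0 _ u0) guc.
have mg0 x : 0 <= max_gauge g x by rewrite le_max enorm_ge0.
split.
- rewrite /max_gauge heis_oneE /= normr0 g0 /enorm /= expr0n/= addr0 sqrtr0.
  by rewrite maxxx.
- move=> [p t]; rewrite /max_gauge/= => e.
  have e1 : enorm p = 0.
    by apply/eqP; rewrite eq_le enorm_ge0 -{1}e le_max lexx.
  have e2 : g `|t| = 0.
    by apply/eqP; rewrite eq_le gge0 ?normr_ge0// -{1}e le_max lexx orbT.
  rewrite heis_oneE (enorm_eq0 e1); congr (_, _).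
  by apply/normr0_eq0; rewrite -[LHS]gK ?normr_ge0// e2 h0 expr0n/= addr0.
- move=> x; rewrite heis_invE /max_gauge/= normrN; congr (Num.max _ _).
  by rewrite /enorm/= !sqrrN.
move=> x y; set a := max_gauge g x; set b := max_gauge g y.
have a0 : 0 <= a := mg0 x.
have b0 : 0 <= b := mg0 y.
have xa : enorm x.1 <= a by rewrite le_max lexx.
have yb : enorm y.1 <= b by rewrite le_max lexx.
have x2a : `|x.2| <= h a + a ^+ 2.
  by apply: leg; [exact: normr_ge0 | rewrite le_max lexx orbT].
have y2b : `|y.2| <= h b + b ^+ 2.
  by apply: leg; [exact: normr_ge0 | rewrite le_max lexx orbT].
rewrite heis_mulE /max_gauge /= ge_max; apply/andP; split.
  apply: le_trans (enormD _ _) _; exact: lerD.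
apply: gle; [exact: normr_ge0 | exact: addr_ge0 |].
have om : `|omega x.1 y.1| <= a * b.
  apply: le_trans (normr_omega _ _) _.
  by apply: ler_pM => //; exact: enorm_ge0.
have := hD _ _ a0 b0.
have := ler_normD (x.2 + y.2) (2 * omega x.1 y.1).
have := ler_normD x.2 y.2.
rewrite normrM ger0_norm//; nra.
Qed.

Lemma sqrt_gauge_norm : group_norm (max_gauge (@Num.sqrt R)).
Proof.
apply: (@max_gauge_norm (fun=> 0)) => //.
- by move=> t t0; rewrite add0r sqrtr_sqr ger0_norm.
- by move=> t t0; rewrite add0r sqr_sqrtr.
Qed.

Definition heis_d := left_inv_metric sqrt_gauge_norm.

(* Functions on [[0, +oo[] are represented by functions on [R]; their values
   at negative reals are irrelevant. *)
Record gauge_profile (k g : R -> R) : Prop := GaugeProfile {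
  profile_convex : @convex_function R R^o `[0, +oo[ k ;
  profile_mono : {in `[0, +oo[ &, {homo k : s t / s < t}} ;
  profile_continuous : k t @[t --> 0^'+] --> k 0 ;
  profile_k_ge0 : forall t : R, 0 <= t -> 0 <= k t ;
  profile_k0 : k 0 = 0 ;
  profile_g_ge0 : forall t : R, 0 <= t -> 0 <= g t ;
  profile_ginvK : forall t : R, 0 <= t -> g (k t + t ^+ 2) = t ;
  profile_gK : forall t : R, 0 <= t -> k (g t) + g t ^+ 2 = t }.

Section rho.
Variables (k g : R -> R).

Lemma profile_superadditive : gauge_profile k g ->
  forall s t : R, 0 <= s -> 0 <= t -> k s + k t <= k (s + t).
Proof.
move=> kg s t s0 t0.
have k0 := profile_k0 kg.
have [->|sN0] := eqVneq s 0; first by rewrite k0 !add0r.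
have st0 : 0 < s + t by rewrite ltr_wpDr// lt_neqAle eq_sym sN0.
have H (a b : R) : 0 <= a -> 0 <= b -> a + b = s + t ->
    k a <= a / (s + t) * k (s + t).
  move=> a0 b0 ab.
  have u0 : 0 <= a / (s + t) by rewrite divr_ge0// ltW.
  have u1 : a / (s + t) <= 1 by rewrite ler_pdivrMr// mul1r -ab lerDl.
  have := @profile_convex _ _ kg (Itv01 u0 u1) (s + t) 0.
  rewrite !inE/= !in_itv/= !andbT => /(_ (ltW st0) (lexx _)).
  rewrite [X in k X](_ : _ = a).
    by rewrite convRE /= k0 mulr0 addr0.
  apply: etrans (convRE _ _ _) _.
  by rewrite /= mulr0 addr0 divfK// gt_eqF.
have Hs := H s t s0 t0 erefl.
have Ht := H t s t0 s0 (addrC _ _).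
apply: le_trans (lerD Hs Ht) _.
by rewrite -mulrDl -mulrDl divff ?mul1r// gt_eqF.
Qed.

(* Hence [rho = max_gauge g] determines a left invariant distance, a theorem of
   Kirchheim and Magnani. *)
Lemma rho_gauge_norm : gauge_profile k g -> group_norm (max_gauge g).
Proof.
move=> kg; apply: (@max_gauge_norm k).
- exact: profile_k0 kg.
- exact: profile_k_ge0 kg.
- exact: profile_superadditive kg.
- exact: profile_g_ge0 kg.
- exact: profile_ginvK kg.
- exact: profile_gK kg.
Qed.

Definition heis_rho (kg : gauge_profile k g) :=
  left_inv_metric (rho_gauge_norm kg).

(* The inverse of [g] when [gauge_profile k g]. *)
Definition ginv (t : R) : R := k t + t ^+ 2.

Definition rho_dil (e : R) x : heisenberg R :=
  ((e * x.1.1, e * x.1.2), Num.sg x.2 * ginv (e * g `|x.2|)).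

Definition rho_dil_field x (e : R) y : heisenberg R :=
  (x * rho_dil e (x^-1 * y))%g.

End rho.

End heisenberg_group.

(* Main.v *)
Require Import Defs.
From mathcomp Require Import all_boot all_order all_algebra.
From mathcomp Require Import ring lra.
From mathcomp Require Import all_classical all_reals all_analysis.

Local Open Scope classical_set_scope.

(** The identity is metrically differentiable as soon as the rescaled gauge
    [g (e ^ 2 t) / e] converges, locally uniformly in [t >= 0], as [e] tends to
    [0]: by left invariance, [rho (x * heis_dil e v, x) / e] is the maximum of
    [|v_1|] and of [g (e ^ 2 |v_2|) / e].

    Write [h e = g (e ^ 2) / e].  Since [g (e ^ 2 t) / e = s h (e s)] with
    [s = sqrt t], the existence of the single limit [h e --> l] is enough, and
    it gives [l * sqrt t] as the limit for [t], uniformly for bounded [t]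
    ([slope_scale]).  This limit may fail to exist for a general profile, as
    [k t / t ^ 2] may oscillate; axiom A4 of the dilatation structure forbids
    it.  For two horizontal vectors with [2 omega = 1], the vertical coordinate
    of the approximate difference [Delta e 1 u v] is [e - ginv (h e)]
    ([Delta_horizontal]), so that A4 makes [ginv (h e)] a Cauchy family.  As
    [k] is nondecreasing, [ginv t = k t + t ^ 2] separates points at least as
    much as the square does ([ginv_separation]); hence [h e] is Cauchy and
    converges ([slope_cvg]).

    The limit [l] lies in [[0, 1]] because [g <= sqrt], and for such [l] the
    function [max (|v_1|, l * sqrt |v_2|)] is subadditive by the same
    computation as for the sqrt gauge.  It is smaller than the norm which
    defines [d], hence 1-Lipschitz, hence a (continuous) seminorm. *)

Import Order.TTheory GRing.Theory Num.Theory.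
Import numFieldNormedType.Exports.
Local Open Scope ring_scope.

(** * The gauge and its inverse *)

Section profile.
Context {R : realType} {k g : R -> R} (kg : gauge_profile k g).

Lemma ginv_ge_sqr (t : R) : 0 <= t -> t ^+ 2 <= ginv k t.
Proof. by move=> t0; rewrite /ginv lerDr (profile_k_ge0 kg). Qed.

Lemma le_ginv (s t : R) : 0 <= s -> s <= t -> ginv k s <= ginv k t.
Proof.
move=> s0 st; have t0 := le_trans s0 st.
have := profile_superadditive kg s0 (t := t - s).
rewrite subr_ge0 subrKC => /(_ st).
have := profile_k_ge0 kg (t := t - s); rewrite subr_ge0 => /(_ st).
rewrite /ginv; nra.
Qed.

Lemma le_ginv_of_gauge (s c : R) : 0 <= s -> g s <= c -> s <= ginv k c.
Proof.
move=> s0 gsc; rewrite -[leLHS](profile_gK kg s0).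
exact: le_ginv (profile_g_ge0 kg s0) gsc.
Qed.

Lemma gauge_le_sqrt (t : R) : 0 <= t -> g t <= Num.sqrt t.
Proof.
move=> t0; have gt0 := profile_g_ge0 kg t0.
rewrite -[leLHS]ger0_norm// -sqrtr_sqr ler_wsqrtr//.
by rewrite -[leRHS](profile_gK kg t0); exact: ginv_ge_sqr.
Qed.

(** For [b <= a], the increment of [k] is nonnegative, and
    [a ^ 2 - b ^ 2 >= (a - b) ^ 2]. *)
Lemma ginv_separation (a b : R) : 0 <= a -> 0 <= b ->
  (a - b) ^+ 2 <= `|ginv k a - ginv k b|.
Proof.
wlog ba : a b / b <= a => [hw a0 b0|a0 b0].
  have [ba|/ltW ab] := leP b a; first exact: hw.
  by rewrite -sqrrN opprB distrC; exact: hw.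
have := profile_superadditive kg b0 (t := a - b).
rewrite subr_ge0 subrKC => /(_ ba).
have := profile_k_ge0 kg (t := a - b); rewrite subr_ge0 => /(_ ba).
have := ler_norm (ginv k a - ginv k b).
rewrite /ginv; nra.
Qed.

(** Continuity of [k] at [0] makes vectors of small [rho]-norm have a small
    vertical coordinate. *)
Lemma ginv_small (r : R) : 0 < r -> exists2 c : R, 0 < c & ginv k c < r.
Proof.
move=> r0; have r20 : 0 < r / 2 by rewrite divr_gt0.
have kn := cvgr_lt _ (profile_continuous kg) (r / 2).
rewrite (profile_k0 kg) in kn.
suff [c [c0 [kc c2]]] : exists c : R, 0 < c /\ k c < r / 2 /\ c ^+ 2 <= r / 2.
  by exists c => //; rewrite /ginv; lra.
have : \forall c \near 0^'+, 0 < c /\ k c < r / 2 /\ c ^+ 2 <= r / 2.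
  near=> c; have c0 : 0 < c by near: c; exact: nbhs_right_gt.
  split => //; split; first by near: c; exact: kn.
  have c1 : c < 1 by near: c; exact: nbhs_right_lt.
  have cr : c < r / 2 by near: c; exact: nbhs_right_lt.
  nra.
by move=> /filter_ex.
Unshelve. all: by end_near. Qed.

(** * Convergence of the rescaled gauge *)

Definition slope (e : R) : R := e^-1 * g (e ^+ 2).

Lemma slope_ge0 (e : R) : 0 < e -> 0 <= slope e.
Proof.
move=> e0; apply: mulr_ge0; first by rewrite invr_ge0 ltW.
by rewrite (profile_g_ge0 kg)// sqr_ge0.
Qed.

Lemma slope_le1 (e : R) : 0 < e -> slope e <= 1.
Proof.
move=> e0; rewrite /slope ler_pdivrMl// mulr1.
by rewrite (le_trans (gauge_le_sqrt _ (sqr_ge0 _)))// sqrtr_sqr gtr0_norm.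
Qed.

(** Horizontal vectors with [2 * omega u v = 1]. *)
Let u : heis_rho kg := ((1, 0), 0) : heisenberg R.
Let v : heis_rho kg := ((0, 1 / 2), 0) : heisenberg R.

Lemma Delta_horizontal (e : R) : 0 < e ->
  Delta (X := heis_rho kg) (rho_dil_field k g) e (1%g : heisenberg R) u v =
  ((e - 1, 1 / 2), e - ginv k (slope e)) :> heisenberg R.
Proof.
move=> e0; have eN0 : e != 0 by rewrite gt_eqF.
rewrite /Delta /rho_dil_field /rho_dil /u /v.
rewrite !(heis_mulE, heis_invE, heis_oneE)/= /omega/=.
rewrite !(mulr0, mul0r, oppr0, add0r, addr0, subr0, sgr0, mulr1).
have -> : 2 * (- e * (e * (1 / 2))) = - e ^+ 2 by field.
rewrite sgrN gtr0_sg ?exprn_gt0// normrN ger0_norm ?sqr_ge0// -/(slope e).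
by congr (_, _, _); field.
Qed.

(** Left invariance turns the hypothesis into a bound on the vertical
    coordinate of [Delta e ^-1 * Delta e'], which is
    [ginv k (slope e) - ginv k (slope e') - 2 (e - e')]. *)
Lemma slope_dist (e e' r : R) : 0 < e -> 0 < e' ->
  mdist
    (Delta (X := heis_rho kg) (rho_dil_field k g) e (1%g : heisenberg R) u v)
    (Delta (X := heis_rho kg) (rho_dil_field k g) e' (1%g : heisenberg R) u v)
    <= r ->
  (slope e - slope e') ^+ 2 <= ginv k r + 2 * `|e - e'|.
Proof.
move=> e0 e'0; rewrite left_inv_mdistE !Delta_horizontal//.
rewrite /max_gauge heis_invE heis_mulE /omega/= ge_max => /andP[_].
move=> /le_ginv_of_gauge => /(_ (normr_ge0 _)) h.
apply: le_trans (ginv_separation _ _ (slope_ge0 _ e0) (slope_ge0 _ e'0)) _.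
set s := (X in `|X| <= _) in h.
have -> : ginv k (slope e) - ginv k (slope e') = s + 2 * (e - e').
  by rewrite /s; field.
by rewrite (le_trans (ler_normD _ _))// normrM (ger0_norm (ler0n _ _)) lerD2r.
Qed.

Lemma slope_cvg : dilatation_A4 (X := heis_rho kg) (rho_dil_field k g) ->
  exists2 l : R, 0 <= l <= 1 &
    forall r : R, 0 < r -> \forall e \near 0^'+, `|slope e - l| < r.
Proof.
move=> [D0 A4].
pose K : set (heis_rho kg) := [set 1%g] `|` [set u] `|` [set v].
have cK : compact K.
  by apply: compactU; [apply: compactU|]; exact: compact_set1.
have /cauchy_cvg/cvg_ex[l hl] : cauchy (slope e @[e --> 0^'+]).
  apply: cauchy_exP => r r0.
  (* The two terms of [slope_dist] are each kept below [r ^ 2 / 2]: the first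
     one by the choice of [c], the second one by [e, e' < r ^ 2 / 4]. *)
  have r22 : 0 < r ^+ 2 / 2 by rewrite divr_gt0// exprn_gt0.
  have [c c0 cr] := ginv_small _ r22.
  have c20 : 0 < c / 2 by rewrite divr_gt0.
  have close : \forall e \near 0^'+, [/\ 0 < e, e < r ^+ 2 / 4 &
      mdist (Delta (X := heis_rho kg) (rho_dil_field k g) e
               (1%g : heisenberg R) u v) (D0 1%g u v) < c / 2].
    near=> e; split.
    - by near: e; exact: nbhs_right_gt.
    - by near: e; apply: nbhs_right_lt; rewrite divr_gt0// exprn_gt0.
    - have : forall x u v, K x -> K u -> K v ->
          mdist (Delta (X := heis_rho kg) (rho_dil_field k g) e x u v)
            (D0 x u v) < c / 2.
        by near: e; exact: A4.
      by apply; [left; left | left; right | right].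
  have [e [e0 er ed]] := filter_ex close.
  exists (slope e); apply: filterS close => e' [e'0 e'r e'd] /=.
  have r_ge0 := ltW r0.
  rewrite /ball/= -ltr_sqr ?nnegrE// real_normK ?num_real//.
  apply: le_lt_trans (slope_dist _ _ c e0 e'0 _) _.
    apply: le_trans (metric_triangle _ (D0 1%g u v) _) _.
    by rewrite (metric_sym (D0 _ _ _)) ltW// [ltRHS]splitr ltrD.
  have : `|e - e'| < r ^+ 2 / 4 by rewrite ltr_norml; apply/andP; split; lra.
  lra.
have near_l (r : R) : 0 < r -> \forall e \near 0^'+, `|slope e - l| < r.
  move=> r0; have /cvgrPdist_lt/(_ r r0) := hl.
  by apply: filterS => e; rewrite distrC.
exists l => //; apply/andP; split.
- apply: (cvgr_to_ge hl); near=> e; apply: slope_ge0.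
  by near: e; exact: nbhs_right_gt.
- apply: (cvgr_to_le hl); near=> e; apply: slope_le1.
  by near: e; exact: nbhs_right_gt.
Unshelve. all: by end_near. Qed.

(** With [s = sqrt t], the rescaled gauge is [s * slope (e * s)], and [e * s]
    is uniformly small for bounded [t]. *)
Lemma slope_scale (l : R) :
  (forall r : R, 0 < r -> \forall e \near 0^'+, `|slope e - l| < r) ->
  forall M r : R, 0 < r -> \forall e \near 0^'+, forall t : R,
    0 <= t -> Num.sqrt t <= M ->
    `|e^-1 * g (e ^+ 2 * t) - l * Num.sqrt t| < r.
Proof.
move=> hl M r r0.
have M1 : 0 < `|M| + 1 by rewrite ltr_wpDl.
have [d /= d0 hd] := hl (r / (`|M| + 1)) ltac:(by rewrite divr_gt0).
near=> e => t t0 tM.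
have e0 : 0 < e by near: e; exact: nbhs_right_gt.
have eN0 : e != 0 by rewrite gt_eqF.
have ed : e < d / (`|M| + 1).
  by near: e; apply: nbhs_right_lt; rewrite divr_gt0.
have := sqr_sqrtr t0; move: tM; have := sqrtr_ge0 t.
set s := Num.sqrt t => s0 sM st; rewrite -st.
have [sE|sN0] := eqVneq s 0.
  have g0 : g 0 = 0.
    by have := profile_ginvK kg (lexx 0); rewrite (profile_k0 kg) expr0n addr0.
  by rewrite sE expr0n/= !mulr0 g0 mulr0 subr0 normr0.
have sp : 0 < s by rewrite lt_neqAle eq_sym sN0.
have sM1 : s < `|M| + 1 by have := ler_norm M; lra.
have -> : e^-1 * g (e ^+ 2 * s ^+ 2) - l * s = s * (slope (e * s) - l).
  by rewrite /slope exprMn; field; rewrite eN0 sN0.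
rewrite normrM gtr0_norm//.
have : `|slope (e * s) - l| < r / (`|M| + 1).
  apply: hd => /=; last by rewrite mulr_gt0.
  rewrite sub0r normrN gtr0_norm ?mulr_gt0//.
  by move: ed; rewrite ltr_pdivlMr//; nra.
by rewrite ltr_pdivlMr//; have := normr_ge0 (slope (e * s) - l); nra.
Unshelve. all: by end_near. Qed.

End profile.

(** * The limit seminorm *)

Section limit_seminorm.
Context {R : realType}.
Implicit Types x y : heisenberg R.

Definition limit_gauge (l : R) : heisenberg R -> R :=
  max_gauge (fun t => l * Num.sqrt t).

Lemma limit_gauge_ge0 l x : 0 <= limit_gauge l x.
Proof. by rewrite le_max enorm_ge0. Qed.

(** If [l > 0], then [l * sqrt] is the inverse of [t ^ 2 / l ^ 2], a profile
    with the superadditive [h t = (l ^ -2 - 1) t ^ 2]. *)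
Lemma limit_gaugeM l x y : 0 <= l <= 1 ->
  limit_gauge l (x * y)%g <= limit_gauge l x + limit_gauge l y.
Proof.
move=> /andP[]; rewrite le_eqVlt => /predU1P[<- _|l0 l1].
  have E z : limit_gauge 0 z = enorm z.1.
    by rewrite /limit_gauge /max_gauge mul0r; apply/max_idPl/enorm_ge0.
  by rewrite !E heis_mulE; exact: enormD.
pose c := l^-2 - 1.
have c0 : 0 <= c by rewrite subr_ge0 invf_ge1 ?exprn_gt0// exprn_ile1// ltW.
have cE (t : R) : c * t ^+ 2 + t ^+ 2 = (l^-1 * t) ^+ 2.
  by rewrite exprMn exprVn /c mulrBl mul1r subrK.
have lN0 : l != 0 by rewrite gt_eqF.
have l_ge0 := ltW l0.
suff : group_norm (limit_gauge l) by move=> /group_normM; exact.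
apply: (@max_gauge_norm _ (fun t => c * t ^+ 2)).
- by rewrite expr0n mulr0.
- by move=> t _; rewrite mulr_ge0 ?sqr_ge0.
- by move=> s t s0 t0; rewrite -mulrDr ler_wpM2l//; nra.
- by move=> t _; rewrite mulr_ge0 ?sqrtr_ge0.
- move=> t t0; rewrite cE sqrtr_sqr ger0_norm ?mulr_ge0 ?invr_ge0//.
  by rewrite mulVKf.
- by move=> t t0; rewrite cE mulKf// sqr_sqrtr.
Qed.

Lemma enormZ (e : R) (p : R * R) : 0 <= e ->
  enorm (e * p.1, e * p.2) = e * enorm p.
Proof.
move=> e0; rewrite /enorm/= !exprMn -mulrDr sqrtrM ?sqr_ge0//.
by rewrite sqrtr_sqr ger0_norm.
Qed.

Lemma limit_gauge_dil l (e : R) x : 0 < e ->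
  limit_gauge l (heis_dil e x) = e * limit_gauge l x.
Proof.
move=> e0; have e_ge0 := ltW e0.
rewrite /limit_gauge /max_gauge /= enormZ// maxr_pMr//; congr (Num.max _ _).
rewrite normrM (ger0_norm (sqr_ge0 e)) sqrtrM ?sqr_ge0//.
by rewrite sqrtr_sqr (gtr0_norm e0) mulrCA.
Qed.

Lemma limit_gauge_le l x : l <= 1 -> limit_gauge l x <= max_gauge Num.sqrt x.
Proof.
move=> l1; rewrite /limit_gauge /max_gauge ge_max !le_max lexx/=.
by apply/orP; right; rewrite ler_piMl ?sqrtr_ge0.
Qed.

(** A subadditive function below the norm of a left invariant distance is
    1-Lipschitz. *)
Lemma subadditive_continuous (G : groupType) (N : G -> R) (hN : group_norm N)
    (f : left_inv_metric hN -> R) :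
  (forall a b, f (a * b)%g <= f a + f b) -> (forall a, f a <= N a) ->
  continuous f.
Proof.
move=> fM fN a; apply/(@cvgrPdist_lt _ _ _ (nbhs a)) => r r0.
have lip (b c : left_inv_metric hN) : f c - f b <= mdist b c.
  rewrite lerBlDl (le_trans _ (lerD (lexx _) (fN _)))//.
  by rewrite -[in leLHS](mulVKg b c); exact: fM.
near=> b.
have ab : mdist a b < r.
  by near: b; have := nbhsx_ballx a r r0; rewrite ballEmdist.
rewrite distrC ltr_norml ltrNl opprB.
by rewrite (le_lt_trans (lip _ _) ab) (le_lt_trans (lip b a)) 1?metric_sym.
Unshelve. all: by end_near. Qed.

Lemma limit_gauge_seminorm l : 0 <= l <= 1 ->
  seminorm (hN := sqrt_gauge_norm R) (@heis_dil R) (limit_gauge l).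
Proof.
move=> l01; split.
- apply: subadditive_continuous => [x y|x]; first exact: limit_gaugeM.
  by apply: limit_gauge_le; case/andP: l01.
- exact: limit_gauge_ge0.
- by move=> e x; exact: limit_gauge_dil.
- by move=> x y; exact: limit_gaugeM.
Qed.

Lemma heis_d_compact_bounded (K : set (heis_d R)) : compact K ->
  exists M : R, forall v, K v -> max_gauge Num.sqrt v <= M.
Proof.
move=> cK; pose f : heis_d R -> R := max_gauge Num.sqrt.
have cf : continuous f.
  apply: subadditive_continuous => // x y.
  exact: group_normM (sqrt_gauge_norm R) _ _.
have [M [_ hM]] : bounded_set (f @` K).
  apply: compact_bounded; apply: continuous_compact cK.
  exact: continuous_subspaceT.
exists (M + 1) => v Kv.
by rewrite (le_trans (ler_norm _))// (hM (M + 1)) ?ltrDl//; exists v.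
Qed.

End limit_seminorm.

(** * Metric differentiability of the identity *)

Lemma maxr_dist_lt (R : realType) (a b c r : R) :
  `|b - c| < r -> `|Num.max a b - Num.max a c| < r.
Proof.
rewrite !ltr_norml => /andP[h1 h2].
by case: (leP a b) => ?; case: (leP a c) => ?; apply/andP; split; lra.
Qed.

Theorem theorem3p3 (R : realType) (k g : R -> R) (kg : gauge_profile k g) :
  dilatation_structure (X := heis_rho kg) (rho_dil_field k g) ->
  forall x : heis_d R,
    metrically_differentiable (hN := sqrt_gauge_norm R) (@heis_dil R)
      (X := heis_rho kg) [set: heis_d R]
      (fun y : heis_d R => (y : heis_rho kg)) x.
Proof.
move=> [_ _ _ _ _ _ /(slope_cvg kg)[l l01 hl]] x.
split; [exact: openT | by [] |].
exists (limit_gauge l); first exact: limit_gauge_seminorm.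
move=> K /heis_d_compact_bounded[M KM] _ r r0.
near=> e => v Kv _.
have e0 : 0 < e by near: e; exact: nbhs_right_gt.
have eN0 : e != 0 by rewrite gt_eqF.
have -> : mdist ((x * heis_dil e v)%g : heis_rho kg) (x : heis_rho kg) =
    max_gauge g (heis_dil e v).
  by rewrite metric_sym left_inv_mdistE mulKg.
rewrite /limit_gauge /max_gauge/= maxr_pMr ?invr_ge0 ?ltW//.
rewrite enormZ ?ltW// mulKf//.
apply: maxr_dist_lt; rewrite normrM (ger0_norm (sqr_ge0 _)).
have : forall t : R, 0 <= t -> Num.sqrt t <= M ->
    `|e^-1 * g (e ^+ 2 * t) - l * Num.sqrt t| < r.
  by near: e; exact: (slope_scale kg).
apply; first exact: normr_ge0.
by rewrite (le_trans _ (KM _ Kv))// le_max lexx orbT.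
Unshelve. all: by end_near. Qed.
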